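(* Under Assumption 1, let $\lambda^0\in\mathbb D$, let $\{(z^k,\lambda^k)\}_{k\ge0}$ be generated by Algorithm (DG), and let $\bar\kappa>0$ be a constant such that $\|\lambda-[\lambda]^W_{\Lambda^*}\|_W\le\bar\kappa\,\|\nabla^+d(\lambda)\|_W$ for all $\lambda\in\mathbb D$ with $\mathcal T(\lambda)\le\mathcal T(\lambda^0)$. Set $\rho=\frac{4(1+\bar\kappa)}{1+4(1+\bar\kappa)}$. Then for all $k\ge0$, \[ f^*-d(\lambda^{k+1})\le\tfrac12\,\rho^{\,k-1}\,\mathcal R(\lambda^0)^2 . \]
   Context: Standing setup. Consider $\min_{z}\ f(z)=\sum_{i=1}^M f_i(z_i)$ subject to $Az=b$, $Cz\le c$, where $z=(z_1,\dots,z_M)$, $z_i\in\mathbb{R}^{n_i}$, $n=\sum_i n_i$, $A\in\mathbb{R}^{p\times n}$, $C\in\mathbb{R}^{q\times n}$, $b\in\mathbb{R}^p$, $c\in\mathbb{R}^q$, and each $f_i:\mathbb{R}^{n_i}\to\mathbb{R}$ is convex. The rows are partitioned into $\bar M$ blocks: $A$ has blocks $A_{ji}\in\mathbb{R}^{p_j\times n_i}$ and $C$ has blocks $C_{ji}\in\mathbb{R}^{q_j\times n_i}$. A matrix $E\in\{0,1\}^{\bar M\times M}$ is given such that $E_{ji}=0$ implies $A_{ji}=0$ and $C_{ji}=0$; $\bar{\mathcal N}_i=\{j: E_{ji}\neq 0\}$, $\mathcal N_j=\{i:E_{ji}\ne 0\}$. Let $G=\begin{bmatrix}A\\ C\end{bmatrix}$,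 $g=\begin{bmatrix}b\\ c\end{bmatrix}$, $\lambda=(\nu,\mu)$, $\mathbb{D}=\mathbb{R}^p\times\mathbb{R}^q_+$, $\mathcal L(z,\lambda)=f(z)+\langle\lambda,Gz-g\rangle$, $d(\lambda)=\min_{z}\mathcal L(z,\lambda)$, $\nabla d(\lambda)=Gz(\lambda)-g$ with $z(\lambda)$ the unique minimizer of $\mathcal L(\cdot,\lambda)$. $L_{d_i}=\big\|\begin{bmatrix}[A_{ji}]_{j\in\bar{\mathcal N}_i}\\ [C_{ji}]_{j\in\bar{\mathcal N}_i}\end{bmatrix}\big\|^2/\sigma_i$; $W=\mathrm{diag}(W_\nu,W_\mu)$, $W_\nu=\mathrm{diag}\big(\sum_{i\in\mathcal N_j}L_{d_i}I_{p_j};\ j\big)$, $W_\mu=\mathrm{diag}\big(\sum_{i\in\mathcal N_j}L_{d_i}I_{q_j};\ j\big)$, assumed positive definite; $\|x\|_W=\sqrt{x^TWx}$. Assumption 1: (a) each $f_i$ is $\sigma_i$-strongly convex and has $L_i$-Lipschitz gradient; (b) $A$ has full row rank and there is $\tilde z$ with $A\tilde z=b$, $C\tilde z<c$. Then the set $\Lambda^*$ of maximizers of $d$ over $\mathbb D$ is nonempty and bounded, and $\max_{\mathbb D}d=f^*$, the primal optimal value. $[x]^W_S$ is the $\|\cdot\|_W$-projection onto a closed convex set $S$; $[x]_{\mathbb D}$ is the Euclidean projection onto $\mathbb D$ (equal to $[x]^W_{\mathbb D}$ since $W$ is diagonal). Proximal residual: $\nabla^+ d(\lambda)=[\lambda+W^{-1}\nabla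 d(\lambda)]^W_{\mathbb D}-\lambda$. $\mathcal R(\lambda)=\min_{\lambda^*\in\Lambda^*}\|\lambda^*-\lambda\|_W$, $\mathcal T(\lambda)=\max_{\lambda^*\in\Lambda^*}\|\lambda-\lambda^*\|_W$. Algorithm (DG): given $\lambda^0\in\mathbb D$, for $k\ge0$ set $z^k=\arg\min_{z}\mathcal L(z,\lambda^k)$ and $\lambda^{k+1}=[\lambda^k+W^{-1}\nabla d(\lambda^k)]_{\mathbb D}$. *)

(* Defs.v *)
From Stdlib Require Import Reals ClassicalEpsilon.
From mathcomp Require Import ssreflect ssrfun ssrbool eqtype ssrnat seq fintype bigop.
Set Implicit Arguments. Unset Strict Implicit.
Local Open Scope R_scope.

Definition vec (n : nat) := 'I_n -> R.
Definition sumR (n : nat) (F : 'I_n -> R) : R := \big[Rplus/0%R]_(i < n) F i.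
Definition vadd n (x y : vec n) : vec n := fun k => x k + y k.
Definition vsub n (x y : vec n) : vec n := fun k => x k - y k.
Definition vscal n (t : R) (x : vec n) : vec n := fun k => t * x k.
Definition dot n (x y : vec n) : R := sumR (fun k => x k * y k).
Definition norm2 n (x : vec n) : R := sqrt (dot x x).

Definition convex n (f : vec n -> R) : Prop :=
  forall x y t, 0 <= t <= 1 ->
    f (vadd (vscal t x) (vscal (1 - t) y)) <= t * f x + (1 - t) * f y.
Definition strongly_convex n (sigma : R) (f : vec n -> R) : Prop :=
  forall x y t, 0 <= t <= 1 ->
    f (vadd (vscal t x) (vscal (1 - t) y))
      <= t * f x + (1 - t) * f y - sigma / 2 * t * (1 - t) * (norm2 (vsub x y)) ^ 2.
Definition is_gradient n (f : vec n -> R) (g : vec n -> vec n) : Prop :=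
  forall x eps, 0 < eps -> exists delta, 0 < delta /\
    forall h, norm2 h < delta ->
      Rabs (f (vadd x h) - f x - dot (g x) h) <= eps * norm2 h.
Definition lipschitz_map n (L : R) (g : vec n -> vec n) : Prop :=
  forall x y, norm2 (vsub (g x) (g y)) <= L * norm2 (vsub x y).

Definition is_min_value {T} (P : T -> Prop) (F : T -> R) (m : R) : Prop :=
  (exists x, P x /\ F x = m) /\ (forall x, P x -> m <= F x).
Definition is_max_value {T} (P : T -> Prop) (F : T -> R) (m : R) : Prop :=
  (exists x, P x /\ F x = m) /\ (forall x, P x -> F x <= m).
Definition min_value {T} (P : T -> Prop) (F : T -> R) : R :=
  epsilon (inhabits 0) (is_min_value P F).
Definition max_value {T} (P : T -> Prop) (F : T -> R) : R :=
  epsilon (inhabits 0) (is_max_value P F).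
Definition argmin_on {T} (t0 : T) (P : T -> Prop) (F : T -> R) : T :=
  epsilon (inhabits t0) (fun x => P x /\ forall y, P y -> F x <= F y).
Definition sup_value (E : R -> Prop) : R := epsilon (inhabits 0) (is_lub E).

Section Problem.
(* M primal blocks z_i in R^(nv i); Mb row blocks with p_j = pv j, q_j = qv j rows. *)
Variables (M Mb : nat) (nv : 'I_M -> nat) (pv qv : 'I_Mb -> nat).
Unset Implicit Arguments.
Variable A : forall (j : 'I_Mb) (i : 'I_M), 'I_(pv j) -> 'I_(nv i) -> R.
Variable C : forall (j : 'I_Mb) (i : 'I_M), 'I_(qv j) -> 'I_(nv i) -> R.
Variable b : forall j : 'I_Mb, vec (pv j).
Variable c : forall j : 'I_Mb, vec (qv j).
Variable f : forall i : 'I_M, vec (nv i) -> R.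
Set Implicit Arguments.
Variable sigma : 'I_M -> R.
Variable E : 'I_Mb -> 'I_M -> bool.

Definition primal := forall i : 'I_M, vec (nv i).
Definition dualv := ((forall j : 'I_Mb, vec (pv j)) * (forall j : 'I_Mb, vec (qv j)))%type.

Definition primal0 : primal := fun i k => 0.
Definition dual0 : dualv := (fun j r => 0, fun j r => 0).

Definition Az (z : primal) (j : 'I_Mb) : vec (pv j) :=
  fun r => sumR (fun i : 'I_M => sumR (fun k : 'I_(nv i) => A j i r k * z i k)).
Definition Cz (z : primal) (j : 'I_Mb) : vec (qv j) :=
  fun r => sumR (fun i : 'I_M => sumR (fun k : 'I_(nv i) => C j i r k * z i k)).

Arguments Az z j : clear implicits.
Arguments Cz z j : clear implicits.

Definition fobj (z : primal) : R := sumR (fun i : 'I_M => f i (z i)).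
Definition feasible (z : primal) : Prop :=
  (forall j r, Az z j r = b j r) /\ (forall j r, Cz z j r <= c j r).
Definition fstar : R := min_value feasible fobj.

Definition Lag (z : primal) (lam : dualv) : R :=
  fobj z + sumR (fun j : 'I_Mb => sumR (fun r : 'I_(pv j) => lam.1 j r * (Az z j r - b j r)))
         + sumR (fun j : 'I_Mb => sumR (fun r : 'I_(qv j) => lam.2 j r * (Cz z j r - c j r))).
Definition dfun (lam : dualv) : R := min_value (fun _ => True) (fun z => Lag z lam).
Definition zopt (lam : dualv) : primal := argmin_on primal0 (fun _ => True) (fun z => Lag z lam).
Definition graddual (lam : dualv) : dualv :=
  (fun j r => Az (zopt lam) j r - b j r, fun j r => Cz (zopt lam) j r - c j r).

Definition inD (lam : dualv) : Prop := forall j r, 0 <= lam.2 j r.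

(* || [A_{ji}; C_{ji}]_{j in Nbar_i} x ||^2 *)
Definition Bnorm2 (i : 'I_M) (x : vec (nv i)) : R :=
  sumR (fun j : 'I_Mb => if E j i then
      sumR (fun r : 'I_(pv j) => (sumR (fun k : 'I_(nv i) => A j i r k * x k)) ^ 2)
    + sumR (fun r : 'I_(qv j) => (sumR (fun k : 'I_(nv i) => C j i r k * x k)) ^ 2) else 0).
Definition opnorm (i : 'I_M) : R :=
  sup_value (fun s => exists x : vec (nv i), norm2 x <= 1 /\ s = sqrt (Bnorm2 x)).
Definition Ld (i : 'I_M) : R := (opnorm i) ^ 2 / sigma i.
(* diagonal weight of W on row block j: sum_{i in N_j} L_{d_i} *)
Definition wdiag (j : 'I_Mb) : R := sumR (fun i : 'I_M => if E j i then Ld i else 0).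

Definition Wquad (lam : dualv) : R :=
  sumR (fun j : 'I_Mb => wdiag j * (sumR (fun r : 'I_(pv j) => (lam.1 j r) ^ 2)
                                   + sumR (fun r : 'I_(qv j) => (lam.2 j r) ^ 2))).
Definition normW (lam : dualv) : R := sqrt (Wquad lam).
Definition Wposdef : Prop :=
  forall lam : dualv, ((exists j r, lam.1 j r <> 0) \/ (exists j r, lam.2 j r <> 0)) ->
    0 < Wquad lam.

Definition eucl_norm (lam : dualv) : R :=
  sqrt (sumR (fun j : 'I_Mb => sumR (fun r : 'I_(pv j) => (lam.1 j r) ^ 2)
                             + sumR (fun r : 'I_(qv j) => (lam.2 j r) ^ 2))).

Definition dadd (x y : dualv) : dualv := (fun j r => x.1 j r + y.1 j r, fun j r => x.2 j r + y.2 j r).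
Definition dsub (x y : dualv) : dualv := (fun j r => x.1 j r - y.1 j r, fun j r => x.2 j r - y.2 j r).
Definition Winv (x : dualv) : dualv := (fun j r => x.1 j r / wdiag j, fun j r => x.2 j r / wdiag j).

Definition projD (x : dualv) : dualv := argmin_on dual0 inD (fun l => eucl_norm (dsub l x)).
Definition projW (S : dualv -> Prop) (x : dualv) : dualv := argmin_on dual0 S (fun l => normW (dsub l x)).

Definition Lstar (lam : dualv) : Prop := inD lam /\ forall l, inD l -> dfun l <= dfun lam.

Definition proxres (lam : dualv) : dualv := dsub (projW inD (dadd lam (Winv (graddual lam)))) lam.
Definition Rcal (lam : dualv) : R := min_value Lstar (fun ls => normW (dsub ls lam)).
Definition Tcal (lam : dualv) : R := max_value Lstar (fun ls => normW (dsub lam ls)).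

Definition DGstep (lam : dualv) : dualv := projD (dadd lam (Winv (graddual lam))).

Definition A_full_row_rank : Prop :=
  forall nu : forall j : 'I_Mb, vec (pv j),
    (forall (i : 'I_M) (k : 'I_(nv i)), sumR (fun j : 'I_Mb => sumR (fun r : 'I_(pv j) => nu j r * A j i r k)) = 0) ->
    forall j r, nu j r = 0.

End Problem.
Arguments Az {M Mb nv pv} A z j _.
Arguments Cz {M Mb nv qv} C z j _.

(* Main.v *)
(** With F = f* - d, the step l -> l+ of (DG) satisfies, for every l' in D, the
    three-point inequality
      d(l') - d(l+) <= (|l' - l|^2 - |l' - l+|^2) / 2      (norms in W),
    because d has the quadratic lower model with curvature W and l+ is the
    projected gradient step for W. Taking l' in Lambda* shows that the iterates
    approach every dual optimum, so T(lam k) <= T(lam 0) and the error bound is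
    available along the whole sequence. Taking l' = l gives
    |l+ - l|^2 <= 2 (F(l) - F(l+)); taking l' = [l]_{Lambda*} and inserting the
    error bound gives F(l+) <= kappa |l+ - l|^2. Together these give
    F(l+) <= rho F(l), and F(lam 1) <= R(lam 0)^2 / 2 is the case k = 0 of the
    three-point inequality.

    Dual optima exist, and Lambda* is compact, because a recession direction of
    a superlevel set of d would contradict the Slater point and the full row
    rank of A. A dual optimum is a fixed point of the step, hence its
    Lagrangian minimizer is primal optimal with the same value. *)
From HB Require Import structures.
Require Import Defs.
From Stdlib Require Import Reals ZArith.
From Stdlib Require Import Lra Lia Classical ClassicalEpsilon FunctionalExtensionality.
From mathcomp Require Import ssreflect ssrfun ssrbool eqtype ssrnat seq choice fintype bigop.
Set Implicit Arguments. Unset Strict Implicit.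
Local Open Scope R_scope.

(** * Finite sums of reals *)

HB.instance Definition _ := Monoid.isComLaw.Build R 0 Rplus
  (fun x y z => esym (Rplus_assoc x y z)) Rplus_comm Rplus_0_l.
HB.instance Definition _ := Monoid.isMulLaw.Build R 0 Rmult Rmult_0_l Rmult_0_r.
HB.instance Definition _ := Monoid.isAddLaw.Build R Rmult Rplus
  Rmult_plus_distr_r Rmult_plus_distr_l.

Notation "\rsum_ i F" := (\big[Rplus/0]_i F)
  (at level 36, F at level 36, i at level 0, format "\rsum_ i  F").

Notation "\rsum_ ( i : T ) F" := (\big[Rplus/0]_(i : T) F)
  (at level 36, F at level 36, i at level 0, format "\rsum_ ( i : T )  F").

Section FiniteSums.
Variable I : finType.
Implicit Types F G : I -> R.

Lemma rsum_add F G : \rsum_i (F i + G i) = \rsum_i F i + \rsum_i G i.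
Proof. exact: big_split. Qed.

Lemma rsum_scal a F : \rsum_i (a * F i) = a * \rsum_i F i.
Proof. by rewrite big_distrr. Qed.

Lemma rsum_sub F G : \rsum_i (F i - G i) = \rsum_i F i - \rsum_i G i.
Proof.
have -> : \rsum_i F i - \rsum_i G i = \rsum_i F i + -1 * \rsum_i G i by ring.
rewrite -rsum_scal -rsum_add; apply: eq_bigr => i _; ring.
Qed.

Lemma rsum_ge0 F : (forall i, 0 <= F i) -> 0 <= \rsum_i F i.
Proof. by move=> h; apply: (big_ind (fun x => 0 <= x)) => // [|x y]; lra. Qed.

Lemma rsum_le F G : (forall i, F i <= G i) -> \rsum_i F i <= \rsum_i G i.
Proof. by move=> h; apply: (big_ind2 Rle) => // [|x y z t]; lra. Qed.

Lemma rsum_ge_term F i : (forall i, 0 <= F i) -> F i <= \rsum_i F i.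
Proof.
move=> h; rewrite (bigD1 i) //=.
have: 0 <= \big[Rplus/0]_(j | j != i) F j
  by apply: (big_ind (fun x => 0 <= x)) => // [|x y]; lra.
lra.
Qed.

Lemma rsum_eq0 F : (forall i, F i = 0) -> \rsum_i F i = 0.
Proof. by move=> h; apply: big1. Qed.

Lemma rsum_delta i F : \rsum_k (if k == i then F k else 0) = F i.
Proof.
rewrite (bigD1 i) //= eqxx big1 ?Rplus_0_r // => k /negbTE ->; by [].
Qed.

Lemma Un_cv_rsum (u : nat -> I -> R) x :
  (forall i, Un_cv (fun n => u n i) (x i)) ->
  Un_cv (fun n => \rsum_i u n i) (\rsum_i x i).
Proof.
move=> h; rewrite !bigop.unlock /reducebig /=.
elim: (index_enum I) => [|i s IH] /=; last exact: CV_plus.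
by move=> e he; exists 0%N => n _; rewrite /R_dist Rminus_diag Rabs_R0.
Qed.

End FiniteSums.

Lemma rsum_tag (n : nat) (p : 'I_n -> nat) (F : forall j, 'I_(p j) -> R) :
  \rsum_(s : {j : 'I_n & 'I_(p j)}) F (tag s) (tagged s) =
  sumR (fun j => sumR (fun r => F j r)).
Proof. by rewrite /sumR sig_big_dep. Qed.

(** * Sequential compactness of bounded sets of vectors *)

Definition increasing_seq (phi : nat -> nat) := forall n, (phi n < phi n.+1)%N.

Lemma increasing_seq_ge phi n : increasing_seq phi -> (n <= phi n)%N.
Proof. by move=> h; elim: n => // n IH; apply: leq_ltn_trans IH (h n). Qed.

Lemma increasing_seq_mono phi n m :
  increasing_seq phi -> (n < m)%N -> (phi n < phi m)%N.
Proof.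
move=> h; elim: m => // m IH; rewrite ltnS leq_eqVlt => /orP[/eqP -> //|/IH H].
exact: ltn_trans H (h m).
Qed.

Lemma increasing_seq_comp phi psi :
  increasing_seq phi -> increasing_seq psi -> increasing_seq (phi \o psi).
Proof. by move=> h1 h2 n /=; apply: increasing_seq_mono. Qed.

Lemma Un_cv_const a : Un_cv (fun _ => a) a.
Proof. by move=> e he; exists 0%N => n _; rewrite /R_dist Rminus_diag Rabs_R0. Qed.

Lemma Un_cv_eq u v l : (forall n, u n = v n) -> Un_cv u l -> Un_cv v l.
Proof. by move=> h; rewrite (functional_extensionality u v h). Qed.

Lemma Un_cv_subseq u l phi :
  increasing_seq phi -> Un_cv u l -> Un_cv (fun n => u (phi n)) l.
Proof.
move=> hphi h e he; have [N hN] := h e he; exists N => n hn.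
apply: hN; have := increasing_seq_ge n hphi; move/leP; lia.
Qed.

Lemma Un_cv_ge u l m : (forall n, m <= u n) -> Un_cv u l -> m <= l.
Proof.
move=> h hl; apply: Rnot_lt_le => hlt.
have [N /(_ N (le_n N))] := hl (m - l) ltac:(lra).
rewrite /R_dist; move/Rabs_def2; have := h N; lra.
Qed.

Lemma Un_cv_scal a u l : Un_cv u l -> Un_cv (fun n => a * u n) (a * l).
Proof. by move=> h; apply: CV_mult h; apply: Un_cv_const. Qed.

(** A Bolzano-Weierstrass cluster point becomes a limit by choosing each index beyond the previous
    one, with its term within [/ INR k.+1] of the point. *)
Lemma bounded_subseq_cv (u : nat -> R) B :
  (forall n, Rabs (u n) <= B) ->
  exists phi, increasing_seq phi /\ exists l, Un_cv (fun n => u (phi n)) l.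
Proof.
move=> hB.
have [l hl] : exists l, ValAdh u l.
  apply: (Bolzano_Weierstrass u (fun x => - B <= x <= B)); first exact: compact_P3.
  move=> n; have := hB n; move=> h; have := Rle_abs (u n); have := Rle_abs (- u n).
  rewrite Rabs_Ropp; lra.
have pick (N k : nat) : {m | (N < m)%N /\ Rabs (u m - l) < / INR k.+1}.
  apply: constructive_indefinite_description.
  have hpos : 0 < / INR k.+1 by apply: Rinv_0_lt_compat; apply: lt_0_INR; lia.
  have [|m [hm1 hm2]] := hl (disc l (mkposreal _ hpos)) N.+1.
    by exists (mkposreal _ hpos).
  by exists m; split; [apply/leP; lia|].
pose phi := fix F n := if n is n'.+1 then sval (pick (F n') n) else sval (pick 0%N 0%N).
exists phi; split; first by move=> n /=; case: (pick _ _) => m [].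
exists l => e he.
have [N [hN0 hN]] := archimed_cor1 e he.
exists N => n hn; rewrite /R_dist.
have h : Rabs (u (phi n) - l) < / INR n.+1.
  by case: (n) => [|n'] /=; case: (pick _ _) => m [].
apply: Rlt_trans h _; apply: Rle_lt_trans hN0; apply: Rinv_le_contravar.
  by apply: lt_0_INR.
by apply: le_INR; lia.
Qed.

Section Compactness.
Variable I : finType.
Implicit Types (S : (I -> R) -> Prop) (x y : I -> R) (u : nat -> I -> R).

Definition cvg_coord u x := forall i, Un_cv (fun n => u n i) (x i).
Definition bounded_set S := exists B, forall x, S x -> forall i, Rabs (x i) <= B.
Definition seq_closed S := forall u x, (forall n, S (u n)) -> cvg_coord u x -> S x.

(** Coordinates are treated one at a time; each extraction refines the previous one, so earlier
    limits survive. *)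
Lemma bounded_subseq_cvg_coord u B :
  (forall n i, Rabs (u n i) <= B) ->
  exists phi, increasing_seq phi /\ exists x, cvg_coord (fun n => u (phi n)) x.
Proof.
move=> hB.
have [phi [hphi h]] : exists phi, increasing_seq phi /\
    forall i, i \in enum I -> exists l, Un_cv (fun n => u (phi n) i) l.
  elim: (enum I) => [|i s [phi [hphi h]]]; first by exists id; split => // n.
  have [psi [hpsi [l hl]]] := bounded_subseq_cv (fun n => hB (phi n) i).
  exists (phi \o psi); split; first exact: increasing_seq_comp.
  move=> k; rewrite in_cons => /orP[/eqP -> |/h [l' hl']]; first by exists l.
  by exists l'; apply: (Un_cv_subseq (u := fun n => u (phi n) k)).
exists phi; split=> //.
have {}h i : exists l, Un_cv (fun n => u (phi n) i) l by apply: h; rewrite mem_enum.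
exists (fun i => epsilon (inhabits 0) (Un_cv (fun n => u (phi n) i))) => i.
exact: epsilon_spec (h i).
Qed.

(** Upper semicontinuity is phrased as closedness of the superlevel sets. Near-maximizers
    subconverge in [S], and closedness carries their lower bounds to the limit. *)
Lemma usc_max_exists S (Phi : (I -> R) -> R) :
  (exists x, S x) -> bounded_set S -> seq_closed S ->
  (forall m, seq_closed (fun x => S x /\ m <= Phi x)) ->
  exists x, S x /\ forall y, S y -> Phi y <= Phi x.
Proof.
move=> [x0 Sx0] [B hB] hcl husc.
(* The second alternative is there because [Phi] is not yet known to be bounded above on [S]. *)
pose near n x := S x /\ forall y, S y -> Phi y <= Phi x + / INR n.+1 \/ INR n <= Phi x.
have hnear n : exists x, near n x.
  apply: NNPP => hno.
  have step x : S x -> exists y, S y /\ Phi x + / INR n.+1 < Phi y /\ Phi x < INR n.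
    move=> Sx; apply: NNPP => hn; apply: hno; exists x; split=> // y Sy.
    case: (Rle_lt_dec (Phi y) (Phi x + / INR n.+1)); first by left.
    move=> h1; right; apply: Rnot_lt_le => h2; apply: hn; exists y; split=> //; lra.
  have grow (k : nat) : exists y, S y /\ Phi x0 + INR k * / INR n.+1 <= Phi y.
    elim: k => [|k [y [Sy hy]]]; first by exists x0; split => //; simpl; lra.
    have [y' [Sy' [h _]]] := step y Sy; exists y'; split=> //.
    rewrite S_INR; lra.
  have hpos : 0 < INR n.+1 by apply: lt_0_INR; lia.
  have [k hk] := INR_unbounded ((INR n - Phi x0) * INR n.+1).
  have [y [Sy hy]] := grow k.
  have [_ [_ [_ h]]] := step y Sy.
  have : (INR n - Phi x0) * INR n.+1 * / INR n.+1 < INR k * / INR n.+1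
    by apply: Rmult_lt_compat_r => //; apply: Rinv_0_lt_compat.
  rewrite Rmult_assoc Rinv_r; lra.
pose u n := epsilon (inhabits x0) (near n).
have hu n : near n (u n) by apply: epsilon_spec (hnear n).
have [phi [hphi [x hx]]] :=
  bounded_subseq_cvg_coord (fun n i => hB _ (proj1 (hu n)) i).
have Sx : S x by apply: hcl hx => n; exact: (proj1 (hu _)).
exists x; split=> // y Sy.
have key m : m < Phi y -> m <= Phi x.
  move=> hm.
  have [N [hN1 hN0]] := archimed_cor1 (Phi y - m) ltac:(lra).
  have [N' hN'] := INR_unbounded m.
  have hcv : cvg_coord (fun n => u (phi (n + (N + N'))%N)) x.
    move=> i; apply: (Un_cv_subseq (u := fun n => u (phi n) i) (phi := fun n => (n + (N + N'))%N)).
      by move=> n; rewrite addSn.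
    exact: hx.
  apply: (proj2 (husc m _ x _ hcv)) => n; set k := phi _.
  have hk : (N + N' <= k)%N.
    by apply: leq_trans (increasing_seq_ge _ hphi); apply: leq_addl.
  have /leP hN := leq_trans (leq_addr N' N) hk.
  have /leP hN'k := leq_trans (leq_addl N N') hk.
  have [Su hu'] := hu k; split=> //.
  case: (hu' y Sy) => h; last by have := le_INR N' k ltac:(lia); lra.
  have : / INR k.+1 <= / INR N.
    by apply: Rinv_le_contravar; [apply: lt_0_INR; lia|apply: le_INR; lia].
  lra.
apply: Rnot_lt_le => hlt.
have := key ((Phi x + Phi y) / 2); lra.
Qed.

Definition seq_continuous (Phi : (I -> R) -> R) :=
  forall u x, cvg_coord u x -> Un_cv (fun n => Phi (u n)) (Phi x).

Lemma continuous_max_exists S Phi :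
  (exists x, S x) -> bounded_set S -> seq_closed S -> seq_continuous Phi ->
  exists x, S x /\ forall y, S y -> Phi y <= Phi x.
Proof.
move=> h0 hB hcl hcont; apply: usc_max_exists => // m u x hu hx; split.
  by apply: hcl hx => n; case: (hu n).
by apply: Un_cv_ge (hcont _ _ hx) => n; case: (hu n).
Qed.

Lemma continuous_min_exists S Phi :
  (exists x, S x) -> bounded_set S -> seq_closed S -> seq_continuous Phi ->
  exists x, S x /\ forall y, S y -> Phi x <= Phi y.
Proof.
move=> h0 hB hcl hcont.
have [|x [Sx h]] := continuous_max_exists (Phi := fun x => - Phi x) h0 hB hcl.
  by move=> u x hu; apply: CV_opp; apply: hcont.
by exists x; split=> // y /h; lra.
Qed.

(** * Weighted squared norms, attainment of minima, and directions at infinity *)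

Definition wsq (w x : I -> R) := \rsum_i (w i * (x i * x i)).

Lemma wsq_ge0 w x : (forall i, 0 < w i) -> 0 <= wsq w x.
Proof. move=> hw; apply: rsum_ge0 => i; have := hw i; nra. Qed.

Lemma wsq_ge_coord w x i : (forall i, 0 < w i) -> w i * (x i * x i) <= wsq w x.
Proof.
move=> hw; apply: (rsum_ge_term (F := fun i => w i * (x i * x i))) => k.
have := hw k; nra.
Qed.

Lemma wsq_eq0 w x : (forall i, 0 < w i) -> wsq w x <= 0 -> forall i, x i = 0.
Proof.
move=> hw h i; have := wsq_ge_coord x i hw; have := hw i => hi h1.
have : x i * x i <= 0 by nra.
nra.
Qed.

Lemma wsq_scal w a x : wsq w (fun i => a * x i) = a * a * wsq w x.
Proof. rewrite /wsq -rsum_scal; apply: eq_bigr => i _; ring. Qed.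

Lemma wsq_continuous w a : seq_continuous (fun x => wsq w (fun i => x i - a i)).
Proof.
move=> u x hu; apply: Un_cv_rsum => i; apply: Un_cv_scal.
by apply: CV_mult; apply: CV_minus; (apply: hu || apply: Un_cv_const).
Qed.

Lemma wsq_sublevel_bounded w r :
  (forall i, 0 < w i) -> bounded_set (fun x => wsq w x <= r).
Proof.
(* The bound rests on [|t| <= 1 + t^2]; summing over the coordinates makes it uniform in [i]. *)
move=> hw; exists (\rsum_i (1 + Rabs r / w i)) => x hx i.
have hpos k : 0 <= Rabs r / w k.
  by apply: Rle_mult_inv_pos; [apply: Rabs_pos|].
apply: Rle_trans (rsum_ge_term (F := fun i => 1 + Rabs r / w i) i _); last first.
  by move=> k; have := hpos k; lra.
have h1 := wsq_ge_coord x i hw; have hi := hw i; have h2 := Rle_abs r.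
have h3 : x i * x i <= Rabs r / w i.
  apply: (Rmult_le_reg_l (w i)) => //; field_simplify; [lra|lra].
have := hpos i; move: (Rabs r / w i) h3 => q h3 h4.
by apply: Rabs_le; nra.
Qed.

Lemma wsq_sub0 w x : wsq w (fun i => x i - 0) = wsq w x.
Proof. by apply: eq_bigr => i _; rewrite Rminus_0_r. Qed.

Lemma wsq_sublevel_closed w r : seq_closed (fun x => wsq w x <= r).
Proof.
move=> u x hu /(wsq_continuous w (fun=> 0)) /CV_opp h.
rewrite -wsq_sub0; apply: Ropp_le_cancel; apply: Un_cv_ge h => n.
by rewrite /opp_seq wsq_sub0; apply: Ropp_le_contravar.
Qed.

(* Sublevel sets are bounded: for z far away, strong convexity on the segment
   [0, z] would push Phi below its minimum on the unit ball. *)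
Lemma strongly_convex_min_exists w Phi :
  (forall i, 0 < w i) -> seq_continuous Phi ->
  (forall x t, 0 <= t <= 1 ->
     Phi (fun i => t * x i) <=
       t * Phi x + (1 - t) * Phi (fun=> 0) - / 2 * t * (1 - t) * wsq w x) ->
  exists x, forall y, Phi x <= Phi y.
Proof.
move=> hw hcont hsc; set x0 : I -> R := fun=> 0.
have w0 : wsq w x0 = 0 by apply: rsum_eq0 => i; rewrite /x0; ring.
have [|z0 [_ hz0]] := continuous_min_exists _ (wsq_sublevel_bounded 1 hw)
  (@wsq_sublevel_closed w 1) hcont.
  by exists x0; rewrite w0; lra.
have hbd : bounded_set (fun x => Phi x <= Phi x0).
  (* For a point of the sublevel set at distance [q > 1], the parameter [/ q] gives a point of the
     unit sphere, whence [Phi z0 <= Phi x0 - (q - 1) / 2], that is [q <= K]. *)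
  pose K := 1 + 2 * (Phi x0 - Phi z0).
  have [B hB] := wsq_sublevel_bounded (K * K) hw.
  exists B => x hx; apply: hB; rewrite /K.
  have hq : Phi z0 <= Phi x0 by apply: hz0; rewrite w0; lra.
  case: (Rle_lt_dec (wsq w x) 1) => h1; first nra.
  set q := sqrt (wsq w x).
  have qq : q * q = wsq w x by apply: sqrt_sqrt; lra.
  have q1 : 1 < q by rewrite /q -sqrt_1; apply: sqrt_lt_1; lra.
  have qi : 0 < / q by apply: Rinv_0_lt_compat; lra.
  have qi' : / q * q = 1 by apply: Rinv_l; lra.
  have qi1 : / q <= 1 by nra.
  have := hsc x (/ q) ltac:(lra).
  have : Phi z0 <= Phi (fun i => / q * x i).
    apply: hz0; rewrite wsq_scal -qq; nra.
  rewrite -qq.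
  have -> : / 2 * / q * (1 - / q) * (q * q) = / 2 * (q - 1) by field; lra.
  rewrite -/x0 => h2 h3.
  have h4 := Rmult_le_compat_l _ _ _ (Rlt_le _ _ qi) hx.
  by apply: Rmult_le_compat; lra.
have [||x [hx h]] := continuous_min_exists (S := fun x => Phi x <= Phi x0) _ hbd _ hcont.
- by exists x0; lra.
- move=> u x hu hx.
  have := Un_cv_ge (m := - Phi x0) _ (CV_opp _ _ (hcont _ _ hx)).
  by rewrite /opp_seq => H; have := H (fun n => Ropp_le_contravar _ _ (hu n)); lra.
exists x => y; case: (Rle_lt_dec (Phi y) (Phi x0)); first exact: h.
lra.
Qed.

(** Points of [S] divided by their norms [N], which tend to infinity, lie on the unit sphere; a
    subsequential limit [v] is still a unit vector. *)
Lemma unbounded_direction S :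
  ~ bounded_set S ->
  exists (x : nat -> I -> R) (N : nat -> R) (v : I -> R),
    [/\ forall n, S (x n), forall n, 0 < N n, cv_infty N,
        cvg_coord (fun n i => / N n * x n i) v & exists i, v i <> 0].
Proof.
move=> hunb.
have far n : exists x, S x /\ exists i, INR n.+1 < Rabs (x i).
  apply: NNPP => hno; apply: hunb; exists (INR n.+1) => x Sx i.
  by apply: Rnot_lt_le => h; apply: hno; exists x; split=> //; exists i.
pose x n := epsilon (inhabits (fun=> 0)) (fun x => S x /\ exists i, INR n.+1 < Rabs (x i)).
have hx n : S (x n) /\ exists i, INR n.+1 < Rabs (x n i) by apply: epsilon_spec (far n).
pose one : I -> R := fun=> 1.
have one0 : forall i, 0 < one i by move=> i; rewrite /one; lra.
pose N n := sqrt (wsq one (x n)).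
have NN n : N n * N n = wsq one (x n) by apply: sqrt_sqrt; apply: wsq_ge0.
have Nge n i : Rabs (x n i) <= N n.
  rewrite -sqrt_Rsqr_abs; apply: sqrt_le_1_alt.
  have := wsq_ge_coord (x n) i one0; rewrite /one /Rsqr; lra.
have Ngt n : INR n.+1 < N n.
  by have [_ [i hi]] := hx n; have := Nge n i; lra.
have N0 n : 0 < N n by have := Ngt n; have := pos_INR n.+1; lra.
have hv n i : Rabs (/ N n * x n i) <= 1.
  rewrite Rabs_mult Rabs_pos_eq; last by apply/Rlt_le/Rinv_0_lt_compat.
  apply: (Rmult_le_reg_l (N n)) => //; rewrite -Rmult_assoc Rinv_r; last by have := N0 n; lra.
  by have := Nge n i; lra.
have [phi [hphi [v hcv]]] := bounded_subseq_cvg_coord hv.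
exists (fun n => x (phi n)), (fun n => N (phi n)), v; split=> //.
- by move=> n; case: (hx (phi n)).
- move=> m; have [k hk] := INR_unbounded m; exists k => n hn.
  have := Ngt (phi n); have := le_INR k (phi n).+1.
  have /leP := increasing_seq_ge n hphi => h1 h2; have := h2 ltac:(lia); lra.
apply: NNPP => hno.
have v0 : wsq one v = 0.
  apply: rsum_eq0 => i; have -> : v i = 0; last by ring.
  by apply: NNPP => h; apply: hno; exists i.
have := wsq_continuous one (fun=> 0) hcv; rewrite wsq_sub0 v0 => h.
suff : 1 <= 0 by lra.
apply: Un_cv_ge h => n; rewrite wsq_sub0 wsq_scal -NN; right; field.
by have := N0 (phi n); lra.
Qed.

End Compactness.

(** * Values and minimizers chosen by [epsilon]; continuity from differentiability *)

Lemma min_value_eq T (P : T -> Prop) F m : is_min_value P F m -> min_value P F = m.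
Proof.
move=> hm; have [[x [Px hx]] h] : is_min_value P F (min_value P F).
  by apply: epsilon_spec; exists m.
have [[y [Py hy]] h'] := hm.
by have := h y Py; have := h' x Px; lra.
Qed.

Lemma max_value_eq T (P : T -> Prop) F m : is_max_value P F m -> max_value P F = m.
Proof.
move=> hm; have [[x [Px hx]] h] : is_max_value P F (max_value P F).
  by apply: epsilon_spec; exists m.
have [[y [Py hy]] h'] := hm.
by have := h y Py; have := h' x Px; lra.
Qed.

Lemma argmin_onP T (t0 : T) P F :
  (exists x, P x /\ forall y, P y -> F x <= F y) ->
  P (argmin_on t0 P F) /\ forall y, P y -> F (argmin_on t0 P F) <= F y.
Proof. exact: epsilon_spec. Qed.

Lemma dot_ge0 n (x : vec n) : 0 <= dot x x.
Proof. by apply: rsum_ge0 => i; nra. Qed.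

Lemma norm2_sq n (x : vec n) : norm2 x * norm2 x = dot x x.
Proof. exact: sqrt_sqrt (dot_ge0 x). Qed.

(** The first-order expansion with tolerance 1 bounds the increment of [f] by [|h| + |<g x, h>|],
    and both terms tend to 0. *)
Lemma gradient_seq_continuous n (f : vec n -> R) g :
  is_gradient f g -> seq_continuous f.
Proof.
move=> hg u x hu e he.
have [d [hd h]] := hg x 1 ltac:(lra).
(* [d] keeps the displacement where the expansion holds; [e / 2] is the share of the remainder, the
   linear term taking the other half. *)
pose m := Rmin d (e / 2).
have hm : 0 < m by apply: Rmin_pos; lra.
have cvh : cvg_coord (fun n i => u n i - x i) (fun=> 0).
  move=> i; have := CV_minus _ _ _ _ (hu i) (Un_cv_const (x i)).
  by rewrite Rminus_diag.
have hdot : Un_cv (fun n => dot (vsub (u n) x) (vsub (u n) x)) 0.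
  have := @Un_cv_rsum _ _ _ (fun i => CV_mult _ _ _ _ (cvh i) (cvh i)).
  by rewrite rsum_eq0 // => i; ring.
have hlin : Un_cv (fun n => dot (g x) (vsub (u n) x)) 0.
  have := @Un_cv_rsum _ _ _ (fun i => Un_cv_scal (g x i) (cvh i)).
  by rewrite rsum_eq0 // => i; ring.
have [N1 h1] := hdot (m * m) ltac:(nra).
have [N2 h2] := hlin (e / 2) ltac:(lra).
exists (N1 + N2)%coq_nat => k hk.
have := h1 k ltac:(lia); have := h2 k ltac:(lia).
rewrite /R_dist !Rminus_0_r => {}h2 {}h1.
have hn : norm2 (vsub (u k) x) < m.
  apply: Rnot_le_lt => hle; have := norm2_sq (vsub (u k) x).
  have := Rle_abs (dot (vsub (u k) x) (vsub (u k) x)); nra.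
have hmd : m <= d by apply: Rmin_l.
have hme : m <= e / 2 by apply: Rmin_r.
have := h (vsub (u k) x) ltac:(lra).
have -> : vadd x (vsub (u k) x) = u k.
  by apply: functional_extensionality => i; rewrite /vadd /vsub; ring.
move=> h3.
have -> : f (u k) - f x =
  (f (u k) - f x - dot (g x) (vsub (u k) x)) + dot (g x) (vsub (u k) x) by ring.
apply: Rle_lt_trans (Rabs_triang _ _) _; lra.
Qed.

(** * The dual problem in coordinates *)

Section DualProblem.
Variables (M Mb : nat) (nv : 'I_M -> nat) (pv qv : 'I_Mb -> nat).
Variable A : forall (j : 'I_Mb) (i : 'I_M), 'I_(pv j) -> 'I_(nv i) -> R.
Variable C : forall (j : 'I_Mb) (i : 'I_M), 'I_(qv j) -> 'I_(nv i) -> R.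
Variable b : forall j : 'I_Mb, vec (pv j).
Variable c : forall j : 'I_Mb, vec (qv j).
Variable f : forall i : 'I_M, vec (nv i) -> R.
Variable sigma : 'I_M -> R.
Variable E : 'I_Mb -> 'I_M -> bool.

Hypothesis HE : forall j i, E j i = false ->
  (forall r k, @A j i r k = 0) /\ (forall r k, @C j i r k = 0).
Hypothesis HW : Wposdef A C sigma E.
Hypothesis Hsig : forall i, 0 < sigma i.
Hypothesis Hsc : forall i, strongly_convex (sigma i) (@f i).
Hypothesis Hcont : forall i, seq_continuous (@f i).
Hypothesis Hrank : A_full_row_rank A.
Hypothesis Hslater : exists zt : primal nv,
  (forall j r, Az A zt j r = b r) /\ (forall j r, Cz C zt j r < c r).

Local Notation dvec := (dualv pv qv).
Local Notation pvec := (primal nv).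
Local Notation row := ({j : 'I_Mb & 'I_(pv j)} + {j : 'I_Mb & 'I_(qv j)})%type.
Local Notation col := {i : 'I_M & 'I_(nv i)}.
Local Notation Lag := (Lag A C b c f).
Local Notation dfun := (dfun A C b c f).
Local Notation zopt := (@zopt M Mb nv pv qv A C b c f).
Local Notation wdiag := (wdiag A C sigma E).
Local Notation Wquad := (Wquad A C sigma E).
Local Notation normW := (normW A C sigma E).
Local Notation opnorm := (opnorm A C E).
Local Notation Ld := (Ld A C sigma E).

(* Dual vectors are flattened to functions on the rows of G: inl for the rows of
   A, inr for those of C. *)
Definition dco (l : dvec) (s : row) : R :=
  match s with inl t => l.1 (tag t) (tagged t) | inr t => l.2 (tag t) (tagged t) end.
Definition dof (y : row -> R) : dvec :=
  (fun j r => y (inl (Tagged (fun j => 'I_(pv j)) r)),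
   fun j r => y (inr (Tagged (fun j => 'I_(qv j)) r))).
Definition pof (x : col -> R) : pvec := fun i k => x (Tagged (fun i => 'I_(nv i)) k).
Arguments pof : clear implicits.
Definition pco (z : pvec) (s : col) : R := z (tag s) (tagged s).

Definition plin (a : R) (x : pvec) (a' : R) (y : pvec) : pvec :=
  fun i k => a * x i k + a' * y i k.
Definition psub (x y : pvec) : pvec := plin 1 x (-1) y.

Definition blk (s : row) : 'I_Mb := match s with inl t => tag t | inr t => tag t end.
Definition wgt (s : row) : R := wdiag (blk s).
Definition Gblk i (s : row) (x : vec (nv i)) : R :=
  match s with
  | inl t => sumR (fun k => @A (tag t) i (tagged t) k * x k)
  | inr t => sumR (fun k => @C (tag t) i (tagged t) k * x k)
  end.
Definition Gz (z : pvec) (s : row) : R := \rsum_i Gblk s (z i).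
Definition gvec (s : row) : R :=
  match s with inl t => @b (tag t) (tagged t) | inr t => @c (tag t) (tagged t) end.
Definition res (z : pvec) (s : row) : R := Gz z s - gvec s.

Lemma dofK y : dco (dof y) = y.
Proof. by apply: functional_extensionality => -[[j r]|[j r]]. Qed.

Lemma dcoK l : dof (dco l) = l.
Proof. by case: l. Qed.

Lemma pcoK z : pof (pco z) = z.
Proof. by []. Qed.

Lemma rsum_row (F : row -> R) :
  \rsum_s F s =
  sumR (fun j => sumR (fun r : 'I_(pv j) => F (inl (Tagged (fun j => 'I_(pv j)) r)))) +
  sumR (fun j => sumR (fun r : 'I_(qv j) => F (inr (Tagged (fun j => 'I_(qv j)) r)))).
Proof.
rewrite big_sumType -!rsum_tag.
by congr (_ + _); apply: eq_bigr => -[].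
Qed.

Lemma rsum_rowD (F : row -> R) :
  \rsum_s F s = sumR (fun j =>
  sumR (fun r : 'I_(pv j) => F (inl (Tagged (fun j => 'I_(pv j)) r))) +
  sumR (fun r : 'I_(qv j) => F (inr (Tagged (fun j => 'I_(qv j)) r)))).
Proof. by rewrite rsum_row /sumR rsum_add. Qed.

Lemma Lag_coord z l : Lag z l = fobj f z + \rsum_s (dco l s * res z s).
Proof. by rewrite rsum_row -Rplus_assoc. Qed.

Lemma Wquad_coord l : Wquad l = wsq wgt (dco l).
Proof.
rewrite /wsq rsum_rowD; apply: eq_bigr => j _; rewrite Rmult_plus_distr_l /sumR -!rsum_scal.
by congr (_ + _); apply: eq_bigr => r _ /=; rewrite /wgt /=; ring.
Qed.

Lemma eucl_norm_coord l : eucl_norm l = sqrt (wsq (fun=> 1) (dco l)).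
Proof.
congr sqrt; rewrite /wsq rsum_rowD; apply: eq_bigr => j _.
by congr (_ + _); apply: eq_bigr => r _ /=; ring.
Qed.

Lemma inD_coord (l : dvec) : inD l <-> forall t, 0 <= dco l (inr t).
Proof.
split=> h; first by move=> t; apply: h.
by move=> j r; apply: (h (Tagged (fun j => 'I_(qv j)) r)).
Qed.

Lemma Bnorm2_coord i (x : vec (nv i)) :
  Bnorm2 A C E x = \rsum_s (if E (blk s) i then Gblk s x * Gblk s x else 0).
Proof.
rewrite rsum_rowD; apply: eq_bigr => j _ /=.
case: (E j i); last by rewrite /sumR !rsum_eq0 ?Rplus_0_r.
by congr (_ + _); apply: eq_bigr => r _; rewrite /=; ring.
Qed.

Lemma Gblk_lin i s a a' (x y : vec (nv i)) :
  Gblk s (fun k => a * x k + a' * y k) = a * Gblk s x + a' * Gblk s y.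
Proof.
by case: s => t /=; rewrite /sumR -!rsum_scal -rsum_add;
  apply: eq_bigr => k _; ring.
Qed.

Lemma Gblk_continuous i s : seq_continuous (@Gblk i s).
Proof.
by move=> u x hu; case: s => t; apply: Un_cv_rsum => k; apply: Un_cv_scal; apply: hu.
Qed.

Lemma Gz_lin a a' (x y : pvec) s :
  Gz (plin a x a' y) s = a * Gz x s + a' * Gz y s.
Proof.
rewrite -!rsum_scal -rsum_add; apply: eq_bigr => i _; exact: Gblk_lin.
Qed.

Lemma Lag_continuous l : seq_continuous (fun x => Lag (pof x) l).
Proof.
move=> u x hu.
apply: (Un_cv_eq (u := fun n => fobj f (pof (u n)) + \rsum_s (dco l s * res (pof (u n)) s))).
  by move=> n; rewrite Lag_coord.
rewrite Lag_coord; apply: CV_plus; first by apply: Un_cv_rsum => i; apply: Hcont => k; apply: hu.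
apply: Un_cv_rsum => s; apply: Un_cv_scal; apply: CV_minus; last exact: Un_cv_const.
by apply: Un_cv_rsum => i; apply: Gblk_continuous => k; apply: hu.
Qed.

Lemma Lag_dual_continuous z : seq_continuous (fun y => Lag z (dof y)).
Proof.
move=> u x hu.
apply: (Un_cv_eq (u := fun n => fobj f z + \rsum_s (u n s * res z s))).
  by move=> n; rewrite Lag_coord dofK.
rewrite Lag_coord dofK; apply: CV_plus; first exact: Un_cv_const.
by apply: Un_cv_rsum => s; apply: CV_mult; [apply: hu|apply: Un_cv_const].
Qed.

(** * Strong convexity of the Lagrangian and its minimizers *)

Definition Qsig (z : pvec) : R := wsq (fun s => sigma (tag s)) (pco z).

Lemma Qsig_blocks z : Qsig z = \rsum_i (sigma i * dot (z i) (z i)).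
Proof.
rewrite /Qsig /wsq (rsum_tag (fun i k => sigma i * (z i k * z i k))).
by apply: eq_bigr => i _; rewrite -rsum_scal.
Qed.

(** The multiplier term is affine in the primal variable, so all curvature comes from the blocks
    [f i]. *)
Lemma Lag_strongly_convex l (x y : pvec) t : 0 <= t <= 1 ->
  Lag (plin t x (1 - t) y) l <=
  t * Lag x l + (1 - t) * Lag y l
  - / 2 * t * (1 - t) * Qsig (psub x y).
Proof.
move=> ht; rewrite !Lag_coord.
have -> : \rsum_s (dco l s * res (plin t x (1 - t) y) s) =
  t * \rsum_s (dco l s * res x s) + (1 - t) * \rsum_s (dco l s * res y s).
  rewrite -!rsum_scal -rsum_add; apply: eq_bigr => s _.
  by rewrite /res Gz_lin; ring.
suff : fobj f (plin t x (1 - t) y) <=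
   t * fobj f x + (1 - t) * fobj f y - / 2 * t * (1 - t) * Qsig (psub x y).
  lra.
rewrite Qsig_blocks /fobj /sumR -!rsum_scal -rsum_add -rsum_sub.
apply: rsum_le => i; have := Hsc (x i) (y i) ht.
rewrite -[norm2 _ ^ 2]/(norm2 _ * (norm2 _ * 1)) Rmult_1_r norm2_sq.
have -> : dot (vsub (x i) (y i)) (vsub (x i) (y i)) = dot (psub x y (i:=i)) (psub x y (i:=i)).
  by apply: eq_bigr => k _; rewrite /vsub /psub /plin; ring.
by rewrite /vadd /vscal /plin; lra.
Qed.

Lemma Lag_min_exists l : exists z, forall z', Lag z l <= Lag z' l.
Proof.
have [|||x hx] := @strongly_convex_min_exists _ (fun s : col => sigma (tag s))
  (fun x => Lag (pof x) l).
- by move=> s; apply: Hsig.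
- exact: Lag_continuous.
- move=> x t ht; have := Lag_strongly_convex l (pof x) (@primal0 M nv) ht.
  have -> : plin t (pof x) (1 - t) (@primal0 M nv) = pof (fun s => t * x s).
    apply: functional_extensionality_dep => i; apply: functional_extensionality => k.
    by rewrite /plin /pof /primal0; ring.
  suff -> : Qsig (psub (pof x) (@primal0 M nv)) = wsq (fun s : col => sigma (tag s)) x by [].
  by apply: eq_bigr => -[i k] _; rewrite /pco /pof /psub /plin /primal0 /= /Tagged; ring.
by exists (pof x) => z; rewrite -(pcoK z).
Qed.

Lemma zopt_min l z : Lag (zopt l) l <= Lag z l.
Proof.
have [z0 h0] := Lag_min_exists l.
apply: (proj2 (argmin_onP (@primal0 M nv) (P := fun=> True) (F := fun z => Lag z l) _) z) => //.
by exists z0.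
Qed.

Lemma dfunE l : dfun l = Lag (zopt l) l.
Proof.
apply: min_value_eq; split; first by exists (zopt l).
by move=> z _; apply: zopt_min.
Qed.

Lemma dfun_le l z : dfun l <= Lag z l.
Proof. by rewrite dfunE; apply: zopt_min. Qed.

Lemma Lag_shift z l l' :
  Lag z l' = Lag z l + \rsum_s ((dco l' s - dco l s) * res z s).
Proof.
rewrite !Lag_coord Rplus_assoc -rsum_add; congr (_ + _).
by apply: eq_bigr => s _; ring.
Qed.

(** Strong convexity between [zopt l] and [z], divided by [t], gives the claim up to a factor
    [1 - t], which a small [t] removes. *)
Lemma Lag_growth l z :
  dfun l + / 2 * Qsig (psub z (zopt l)) <= Lag z l.
Proof.
rewrite dfunE; set q := Qsig _.
have h t : 0 < t <= 1 -> / 2 * (1 - t) * q <= Lag z l - Lag (zopt l) l.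
  move=> ht; have := Lag_strongly_convex l z (zopt l) (t := t) ltac:(lra).
  have := zopt_min l (plin t z (1 - t) (zopt l)).
  rewrite -/q => h1 h2; apply: (Rmult_le_reg_l t); nra.
have q0 : 0 <= q by apply: wsq_ge0.
apply: Rnot_lt_le => hlt; set D := Lag z l - Lag (zopt l) l in h.
have D0 : 0 <= D by have := h 1 ltac:(lra); lra.
have qpos : 0 < q by rewrite /D in D0; lra.
have hD : D < / 2 * q by rewrite /D; lra.
(* If [D < q / 2], this [t] makes [(1 - t) * q / 2] equal to [(q + 2 * D) / 4], which exceeds [D]
   and contradicts [h]. *)
pose t := (q - 2 * D) / (2 * q).
have tq : t * q = (q - 2 * D) / 2 by rewrite /t; field; lra.
have := h t ltac:(split; nra); nra.
Qed.

(** * Block operator norms and the quadratic lower model of the dual function *)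

Lemma Bnorm2_continuous i : seq_continuous (@Bnorm2 M Mb nv pv qv A C E i).
Proof.
move=> u x hu; rewrite Bnorm2_coord.
apply: (Un_cv_eq (u := fun n => \rsum_s (if E (blk s) i then Gblk s (u n) * Gblk s (u n) else 0))).
  by move=> n; rewrite Bnorm2_coord.
apply: Un_cv_rsum => s; case: (E _ _); last exact: Un_cv_const.
by apply: CV_mult; apply: Gblk_continuous.
Qed.

Lemma Bnorm2_ge0 i (x : vec (nv i)) : 0 <= Bnorm2 A C E x.
Proof. rewrite Bnorm2_coord; apply: rsum_ge0 => s; case: (E _ _); nra. Qed.

Lemma Bnorm2_scal i a (x : vec (nv i)) :
  Bnorm2 A C E (fun k => a * x k) = a * a * Bnorm2 A C E x.
Proof.
rewrite !Bnorm2_coord -rsum_scal; apply: eq_bigr => s _.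
have -> : (fun k => a * x k) = (fun k => a * x k + 0 * x k).
  by apply: functional_extensionality => k; ring.
by rewrite Gblk_lin; case: (E _ _); ring.
Qed.

(** [Bnorm2] attains a maximum on the compact unit ball, so the supremum is finite and [epsilon]
    really selects it. *)
Lemma opnorm_lub i :
  is_lub (fun s => exists x : vec (nv i), norm2 x <= 1 /\ s = sqrt (Bnorm2 A C E x)) (opnorm i).
Proof.
apply: epsilon_spec.
pose one : 'I_(nv i) -> R := fun=> 1.
have one0 : forall k, 0 < one k by move=> k; rewrite /one; lra.
have Eone x : wsq one x = dot x x by apply: eq_bigr => k _; rewrite /one; ring.
have x0 : dot (fun _ : 'I_(nv i) => 0) (fun=> 0) = 0 by apply: rsum_eq0 => k; ring.
have [|x [hx h]] := continuous_max_exists _ (wsq_sublevel_bounded 1 one0)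
  (@wsq_sublevel_closed _ one 1) (@Bnorm2_continuous i).
  by exists (fun=> 0); rewrite Eone x0; lra.
pose S s := exists x : vec (nv i), norm2 x <= 1 /\ s = sqrt (Bnorm2 A C E x).
case: (completeness S) => [||m]; last by exists m.
- exists (sqrt (Bnorm2 A C E (x : vec (nv i)))) => _ [y [hy ->]]; apply: sqrt_le_1_alt; apply: h.
  rewrite Eone -norm2_sq; have : 0 <= norm2 y by apply: sqrt_pos.
  nra.
- by exists (sqrt (Bnorm2 A C E ((fun=> 0) : vec (nv i)))), (fun=> 0); split=> //;
  rewrite /norm2 x0 sqrt_0; lra.
Qed.

(** By homogeneity a nonzero [x] reduces to the unit vector in its direction. *)
Lemma Bnorm2_le_opnorm i (x : vec (nv i)) :
  Bnorm2 A C E x <= opnorm i * opnorm i * dot x x.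
Proof.
have B0 := Bnorm2_ge0 x.
case: (Rle_lt_dec (dot x x) 0) => [h|h].
  have x0 k : x k = 0.
    apply: (wsq_eq0 (w := fun=> 1) (x := x)); first by move=> _; lra.
    by apply: Rle_trans h; right; apply: eq_bigr => j _; ring.
  have -> : x = (fun k => 0 * x k).
    by apply: functional_extensionality => k; rewrite x0; ring.
  rewrite Bnorm2_scal; have := dot_ge0 (fun k => 0 * x k) => h'.
  have : 0 <= opnorm i * opnorm i by nra.
  nra.
set q := norm2 x; have qq : q * q = dot x x := norm2_sq x.
have q0 : 0 < q by apply: sqrt_lt_R0.
have [ub _] := opnorm_lub i.
have hs : sqrt (Bnorm2 A C E (fun k => / q * x k)) <= opnorm i.
  apply: ub; exists (fun k => / q * x k); split=> //.
  rewrite -sqrt_1; apply: sqrt_le_1_alt; right.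
  have -> : dot (fun k => / q * x k) (fun k => / q * x k) = / q * / q * dot x x.
    by rewrite -rsum_scal; apply: eq_bigr => k _; ring.
  by rewrite -qq; field; lra.
move: hs; rewrite Bnorm2_scal; set B := Bnorm2 A C E x in B0 * => hs.
have qi : 0 < / q by apply: Rinv_0_lt_compat.
have h1 : 0 <= / q * / q * B by nra.
have h2 := sqrt_pos (/ q * / q * B).
have h3 := sqrt_sqrt _ h1.
have h4 : / q * / q * B <= opnorm i * opnorm i by nra.
have -> : B = q * q * (/ q * / q * B) by field; lra.
rewrite -qq; nra.
Qed.

Lemma Ld_ge0 i : 0 <= Ld i.
Proof. apply: Rle_mult_inv_pos; [exact: pow2_ge_0|exact: Hsig]. Qed.

Lemma Gblk_out i s (x : vec (nv i)) : E (blk s) i = false -> Gblk s x = 0.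
Proof.
by case: s => t /= /HE [hA hC]; apply: rsum_eq0 => k; rewrite ?hA ?hC; ring.
Qed.

(** Young's inequality with parameter [Ld i] on each row leaves [/ 2 * / Ld i] times the sum of the
    squared [Gblk s x], which the quadratic in [x] covers because [opnorm i] squared is
    [Ld i * sigma i]. *)
Lemma block_young i (D : row -> R) (x : vec (nv i)) :
  0 <= / 2 * (sigma i * dot x x) + \rsum_s (D s * Gblk s x)
       + / 2 * \rsum_s (if E (blk s) i then Ld i * (D s * D s) else 0).
Proof.
have hB := Bnorm2_le_opnorm x; have B0 := Bnorm2_ge0 x.
have si := Hsig i; have d0 := dot_ge0 x.
have hL : opnorm i * opnorm i = Ld i * sigma i.
  by rewrite /Ld; field; lra.
rewrite hL in hB.
(* Young's inequality divides by [Ld i]; when that vanishes, so does every row of the block. *)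
case: (Rle_lt_dec (Ld i) 0) => hl.
  have L0 : Ld i = 0 by have := Ld_ge0 i; lra.
  have G0 s : D s * Gblk s x = 0.
    case Es: (E (blk s) i); last by rewrite Gblk_out //; ring.
    suff -> : Gblk s x = 0 by ring.
    have := rsum_ge_term (F := fun s => if E (blk s) i then Gblk s x * Gblk s x else 0) s _.
    rewrite -Bnorm2_coord Es L0 in hB * => H.
    have : Gblk s x * Gblk s x <= 0.
      apply: Rle_trans (H _) _; last by lra.
      by move=> s'; case: (E _ _); nra.
    by move: (Gblk s x) => w; nra.
  rewrite (rsum_eq0 G0) rsum_eq0; first nra.
  by move=> s; rewrite L0; case: (E _ _); ring.
have h s : - (/ 2 * (/ Ld i * (if E (blk s) i then Gblk s x * Gblk s x else 0))) <=
    D s * Gblk s x + / 2 * (if E (blk s) i then Ld i * (D s * D s) else 0).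
  case Es: (E (blk s) i); last by rewrite Gblk_out //; lra.
  have : 0 <= / 2 * / Ld i * ((Ld i * D s + Gblk s x) * (Ld i * D s + Gblk s x)).
    apply: Rmult_le_pos; last exact: Rle_0_sqr.
    by have := Rinv_0_lt_compat _ hl; lra.
  have -> : / 2 * / Ld i * ((Ld i * D s + Gblk s x) * (Ld i * D s + Gblk s x)) =
    / 2 * (Ld i * (D s * D s)) + D s * Gblk s x + / 2 * (/ Ld i * (Gblk s x * Gblk s x))
    by field; lra.
  lra.
have := rsum_le h; rewrite rsum_add rsum_scal.
have -> : \rsum_s (- (/ 2 * (/ Ld i * (if E (blk s) i then Gblk s x * Gblk s x else 0)))) =
   - (/ 2 * (/ Ld i * Bnorm2 A C E x)).
  rewrite Bnorm2_coord.
  have -> (u : R) : - (/ 2 * (/ Ld i * u)) = - (/ 2 * / Ld i) * u by ring.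
  by rewrite -rsum_scal; apply: eq_bigr => s _; ring.
have : / Ld i * Bnorm2 A C E x <= sigma i * dot x x.
  apply: (Rmult_le_reg_l (Ld i)) => //; rewrite -Rmult_assoc Rinv_r; lra.
lra.
Qed.

Lemma rsum_exchange (S T : finType) (F : S -> T -> R) :
  \rsum_s \rsum_t F s t = \rsum_t \rsum_s F s t.
Proof. exact: exchange_big. Qed.

(** The growth of the Lagrangian for [l], evaluated at the minimizer for [l'], absorbs the cross
    term [<D, G h>] block by block. *)
Lemma dual_descent l l' :
  dfun l + \rsum_s ((dco l' s - dco l s) * res (zopt l) s)
    - / 2 * wsq wgt (fun s => dco l' s - dco l s) <= dfun l'.
Proof.
set z' := zopt l'; rewrite (dfunE l') -/z' (Lag_shift _ l).
have := Lag_growth l z'; set h := psub _ _ => hg.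
set D := fun s => dco l' s - dco l s.
have -> : \rsum_s ((dco l' s - dco l s) * res z' s) =
   \rsum_s ((dco l' s - dco l s) * res (zopt l) s) + \rsum_s (D s * Gz h s).
  rewrite -rsum_add; apply: eq_bigr => s _.
  by rewrite /h Gz_lin /res /D; ring.
suff : 0 <= / 2 * Qsig h + \rsum_s (D s * Gz h s) + / 2 * wsq wgt D by lra.
have -> : \rsum_s (D s * Gz h s) = \rsum_i \rsum_s (D s * Gblk s (h i)).
  by rewrite rsum_exchange; apply: eq_bigr => s _; rewrite -rsum_scal.
(* This is where the form of W enters: a row weighs the sum of [Ld i] over the primal blocks that
   [E] attaches to it. *)
have -> : wsq wgt D = \rsum_i \rsum_s (if E (blk s) i then Ld i * (D s * D s) else 0).
  rewrite rsum_exchange; apply: eq_bigr => s _.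
  rewrite Rmult_comm -rsum_scal; apply: eq_bigr => i _.
  by case: (E _ _); ring.
rewrite Qsig_blocks -!rsum_scal -!rsum_add.
by apply: rsum_ge0 => i; apply: block_young.
Qed.

(** Positive definiteness is tested on the coordinate vector of row [s]. *)
Lemma wgt_gt0 s : 0 < wgt s.
Proof.
pose d := fun s' : row => if s' == s then 1 else 0.
have := HW (lam := dof d).
have -> : Wquad (dof d) = wgt s.
  rewrite Wquad_coord dofK -(rsum_delta s wgt); apply: eq_bigr => s' _.
  by rewrite /d; case: eqP => _; ring.
apply; case: s @d => -[j r] d; [left|right]; exists j, r.
all: by rewrite /dof /d /= eqxx; lra.
Qed.

(** * Projections and the dual gradient step *)

Definition posD (y : row -> R) (s : row) : R :=
  match s with inl _ => y s | inr _ => Rmax 0 (y s) end.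

Lemma posD_inD y : inD (dof (posD y)).
Proof. by apply/inD_coord => t; rewrite dofK; apply: Rmax_l. Qed.

Lemma posD_vi y l s : inD l -> 0 <= (dco l s - posD y s) * (posD y s - y s).
Proof.
move=> /inD_coord; case: s => t hl; first by rewrite /=; nra.
have /= := hl t; rewrite /Rmax; case: Rle_dec => h1 h2; nra.
Qed.

(** D is a product of lines and half-lines, so all positive diagonal weights give the same
    projection. The obtuse-angle inequality also gives uniqueness, which pins down the minimizer
    chosen by [epsilon]. *)
Lemma argmin_posD w (N : dvec -> R) (x : dvec) :
  (forall s, 0 < w s) ->
  (forall l, N l = sqrt (wsq w (fun s => dco l s - dco x s))) ->
  argmin_on (dual0 pv qv) (@inD Mb pv qv) N = dof (posD (dco x)).
Proof.
move=> hw hN; set p := posD (dco x).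
have obtuse l : inD l -> wsq w (fun s => p s - dco x s) + wsq w (fun s => dco l s - p s) <=
    wsq w (fun s => dco l s - dco x s).
  move=> hl; rewrite -rsum_add; apply: rsum_le => s.
  have := posD_vi (dco x) s hl; rewrite -/p; have := hw s; nra.
have [|hD hmin] := @argmin_onP _ (dual0 pv qv) (@inD Mb pv qv) N.
  exists (dof p); split=> [|l hl]; first exact: posD_inD.
  rewrite !hN dofK; apply: sqrt_le_1_alt; have := obtuse l hl.
  have := wsq_ge0 (fun s => dco l s - p s) hw; lra.
set l := argmin_on _ _ _ in hD hmin *.
have := hmin _ (posD_inD (dco x)); rewrite !hN dofK -/p => h.
have := obtuse l hD.
have h' := sqrt_le_0 _ _ (wsq_ge0 _ hw) (wsq_ge0 _ hw) h.
rewrite -(dcoK l) => h2; congr dof.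
apply: functional_extensionality => s.
have : wsq w (fun s => dco l s - p s) <= 0 by rewrite dcoK in h2; lra.
move/(wsq_eq0 hw)/(_ s); lra.
Qed.

Lemma normW_dsub l l' :
  normW (dsub l l') = sqrt (wsq wgt (fun s => dco l s - dco l' s)).
Proof.
by rewrite /Defs.normW Wquad_coord; congr sqrt; apply: eq_bigr => -[t|t].
Qed.

Lemma projD_coord x : projD x = dof (posD (dco x)).
Proof.
apply: (argmin_posD (w := fun=> 1)) => [s|l]; first lra.
by rewrite eucl_norm_coord; congr sqrt; apply: eq_bigr => -[t|t].
Qed.

Lemma projW_inD_coord x : projW A C sigma E (@inD Mb pv qv) x = dof (posD (dco x)).
Proof. by apply: (argmin_posD wgt_gt0) => l; rewrite normW_dsub. Qed.

Local Notation DGstep := (DGstep A C b c f sigma E).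
Local Notation proxres := (proxres A C b c f sigma E).
Local Notation Lstar := (Lstar A C b c f).

Definition gstep (l : dvec) (s : row) : R := dco l s + res (zopt l) s / wgt s.

Lemma DGstepE l : DGstep l = dof (posD (gstep l)).
Proof.
rewrite /Defs.DGstep projD_coord; congr (dof (posD _)).
by apply: functional_extensionality => -[t|t].
Qed.

(** Both projections are the same clipping; the error bound can thus be read as a bound by the step
    length. *)
Lemma proxresE l : proxres l = dsub (DGstep l) l.
Proof. by rewrite /Defs.proxres /Defs.DGstep projD_coord projW_inD_coord. Qed.

Lemma DGstep_inD l : inD (DGstep l).
Proof. by rewrite DGstepE; apply: posD_inD. Qed.

Definition dist2 (l l' : dvec) : R := wsq wgt (fun s => dco l s - dco l' s).

Lemma dist2_ge0 l l' : 0 <= dist2 l l'.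
Proof. exact: wsq_ge0 wgt_gt0. Qed.

Lemma dist2_sym l l' : dist2 l l' = dist2 l' l.
Proof. by apply: eq_bigr => s _; ring. Qed.

Lemma normW_dsub_sqr l l' : normW (dsub l l') * normW (dsub l l') = dist2 l l'.
Proof. by rewrite normW_dsub; apply: sqrt_sqrt; apply: wsq_ge0 wgt_gt0. Qed.

Lemma normW_dsub_le x y x' y' :
  dist2 x y <= dist2 x' y' -> normW (dsub x y) <= normW (dsub x' y').
Proof. by move=> h; rewrite !normW_dsub; apply: sqrt_le_1_alt. Qed.

(** The Lagrangian at [zopt l] bounds [dfun l'] above, and [dual_descent] bounds [dfun (DGstep l)]
    below. The rest splits over the rows, where the variational inequality [posD_vi] settles it. *)
Lemma DGstep_progress l l' : inD l' ->
  dfun l' - dfun (DGstep l) <= / 2 * dist2 l' l - / 2 * dist2 l' (DGstep l).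
Proof.
move=> hl'; have h1 := dual_descent l (DGstep l).
have h2 := dfun_le l' (zopt l); rewrite (Lag_shift _ l) -dfunE in h2.
suff : \rsum_s ((dco l' s - dco l s) * res (zopt l) s)
     - \rsum_s ((dco (DGstep l) s - dco l s) * res (zopt l) s)
     + / 2 * wsq wgt (fun s => dco (DGstep l) s - dco l s)
   <= / 2 * dist2 l' l - / 2 * dist2 l' (DGstep l) by lra.
rewrite /dist2 /wsq -rsum_sub -!rsum_scal -rsum_sub -rsum_add; apply: rsum_le => s.
rewrite DGstepE dofK; have := posD_vi (gstep l) s hl'.
set p := posD _ _; have hw := wgt_gt0 s.
have : wgt s * gstep l s = wgt s * dco l s + res (zopt l) s.
  by rewrite /gstep; field; lra.
nra.
Qed.

(** * Dual attainment and strong duality *)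

Definition superlevel m (y : row -> R) := inD (dof y) /\ m <= dfun (dof y).

(** [dfun] is an infimum of functions affine in the multiplier, hence upper semicontinuous: the
    Lagrangian at the minimizer of the limit point is continuous and dominates [dfun] along the
    sequence. *)
Lemma superlevel_closed m : seq_closed (superlevel m).
Proof.
move=> u x hu hx; split.
  apply/inD_coord => t; rewrite dofK; apply: Un_cv_ge (hx (inr t)) => n.
  by have [/inD_coord /(_ t)] := hu n; rewrite dofK.
rewrite dfunE; apply: Un_cv_ge (Lag_dual_continuous _ hx) => n.
by have [_ h] := hu n; apply: Rle_trans h (dfun_le _ _).
Qed.

Definition Gcoef (s : row) i (k : 'I_(nv i)) : R :=
  match s with
  | inl t => @A (tag t) i (tagged t) k
  | inr t => @C (tag t) i (tagged t) k
  end.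

Lemma Gz_adjoint (v : row -> R) (h : pvec) :
  \rsum_s (v s * Gz h s) =
  \rsum_i \rsum_(k : 'I_(nv i)) (h i k * \rsum_s (v s * Gcoef s k)).
Proof.
have -> : \rsum_s (v s * Gz h s) = \rsum_s \rsum_i (v s * Gblk s (h i)).
  by apply: eq_bigr => s _; rewrite rsum_scal.
rewrite rsum_exchange; apply: eq_bigr => i _.
have -> : \rsum_s (v s * Gblk s (h i)) = \rsum_s \rsum_(k : 'I_(nv i)) (h i k * (v s * Gcoef s k)).
  apply: eq_bigr => s _; have -> : Gblk s (h i) = \rsum_k (Gcoef s k * h i k) by case: s.
  by rewrite -rsum_scal; apply: eq_bigr => k _; ring.
by rewrite rsum_exchange; apply: eq_bigr => k _; rewrite rsum_scal.
Qed.

(* The affine function <v, G z - g> is nonnegative along a recession direction v: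
   the Slater point kills its inequality part, full row rank the rest. *)
Lemma recession_trivial (v : row -> R) :
  (forall t, 0 <= v (inr t)) -> (forall z, 0 <= \rsum_s (v s * res z s)) ->
  forall s, v s = 0.
Proof.
move=> v0 hrec; have [zt [hA hC]] := Hslater.
have rl t : res zt (inl t) = 0 by exact: Rminus_diag_eq (hA _ (tagged t)).
have rr t : res zt (inr t) < 0 by exact: Rlt_minus (hC _ (tagged t)).
(* At the Slater point no term is positive while the sum is nonnegative, so every term vanishes. *)
have F0 s : 0 <= - 1 * (v s * res zt s).
  by case: s => t; [rewrite rl|have := rr t; have := v0 t]; nra.
have Feq s : v s * res zt s = 0.
  have := rsum_ge_term s F0; rewrite rsum_scal; have := F0 s; have := hrec zt; lra.
have vr t : v (inr t) = 0 by have := Feq (inr t); have := rr t; nra.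
have hlin h : 0 <= \rsum_s (v s * Gz h s).
  have := hrec (plin 1 zt 1 h).
  suff -> : \rsum_s (v s * res (plin 1 zt 1 h) s) = \rsum_s (v s * Gz h s) by [].
  apply: eq_bigr => s _; rewrite /res Gz_lin; have := Feq s; rewrite /res; lra.
pose a : pvec := fun i k => \rsum_s (v s * Gcoef s k).
have a0 i k : a i k = 0.
  have neg r : 0 <= -1 * r -> r <= 0 by lra.
  (* Testing the linear form with [-a], where [a] is [G^T v], gives [-|a|^2 >= 0]. *)
  have := hlin (plin (-1) a 0 a); rewrite Gz_adjoint.
  have -> : \rsum_i \rsum_(k : 'I_(nv i)) (plin (-1) a 0 a k * \rsum_s (v s * Gcoef s k)) =
     -1 * \rsum_i \rsum_(k : 'I_(nv i)) (a i k * a i k).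
    rewrite -rsum_scal; apply: eq_bigr => i' _; rewrite -rsum_scal.
    by apply: eq_bigr => k' _; rewrite /plin -/(a i' k'); ring.
  have hk i' : forall k' : 'I_(nv i'), 0 <= a i' k' * a i' k' by move=> k'; exact: Rle_0_sqr.
  move=> /neg h; have : a i k * a i k <= 0; last by move: (a i k) => q; nra.
  have h' := rsum_ge_term i (fun i' => rsum_ge0 (hk i')).
  exact: Rle_trans (rsum_ge_term k (hk i)) (Rle_trans _ _ _ h' h).
case=> t; last exact: vr.
have := Hrank (nu := fun j r => v (inl (Tagged (fun j => 'I_(pv j)) r))) _ (tagged t).
case: t => j r /=; apply=> i k; rewrite -(a0 i k) /a rsum_row.
rewrite -[LHS]Rplus_0_r; congr (_ + _).
by rewrite /sumR rsum_eq0 // => j'; apply: rsum_eq0 => r'; rewrite vr; ring.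
Qed.

(** For fixed [z], dividing [m <= Lag z (dof (x n))] by [N n] and letting [n] grow shows that the
    limit direction meets the hypotheses of [recession_trivial], so it cannot be nonzero. *)
Lemma superlevel_bounded m : bounded_set (superlevel m).
Proof.
apply: NNPP => /unbounded_direction [x [N [v [hS hN hNinf hcv [s hs]]]]].
apply: hs; apply: recession_trivial => [t|z].
  apply: Un_cv_ge (hcv (inr t)) => n; apply: Rmult_le_pos.
    exact/Rlt_le/Rinv_0_lt_compat.
  by have [/inD_coord /(_ t)] := hS n; rewrite dofK.
have hinv : Un_cv (fun n => / N n) 0.
  by apply: cv_infty_cv_0 => //; move=> n; have := hN n; lra.
have h1 : Un_cv (fun n => \rsum_s (/ N n * x n s * res z s)) (\rsum_s (v s * res z s)).
  by apply: Un_cv_rsum => s'; apply: CV_mult; [apply: hcv|apply: Un_cv_const].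
have := CV_minus _ _ _ _ h1 (CV_mult _ _ _ _ hinv (Un_cv_const (m - fobj f z))).
rewrite Rmult_0_l Rminus_0_r => h2; apply: Un_cv_ge h2 => n.
have [_ hm] := hS n; have := dfun_le (dof (x n)) z; rewrite Lag_coord dofK => h3.
have -> : \rsum_s (/ N n * x n s * res z s) = / N n * \rsum_s (x n s * res z s).
  by rewrite -rsum_scal; apply: eq_bigr => s' _; ring.
rewrite -Rmult_minus_distr_l; apply: Rmult_le_pos; last lra.
exact/Rlt_le/Rinv_0_lt_compat.
Qed.

(** A maximizer over the compact superlevel set through the origin is global, since points of D
    outside that set have smaller values. *)
Lemma Lstar_nonempty : exists ls, Lstar ls.
Proof.
pose m0 := dfun (dual0 pv qv).
have S0 : superlevel m0 (dco (dual0 pv qv)).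
  by split; rewrite dcoK; [move=> j r /=; lra|rewrite /m0; lra].
have [|x [[hD h0] hx]] := usc_max_exists (Phi := fun y => dfun (dof y))
  (ex_intro _ _ S0) (superlevel_bounded m0) (superlevel_closed (m := m0)).
  move=> m u x hu hx; split; first by apply: superlevel_closed hx => n; case: (hu n).
  apply: (proj2 (@superlevel_closed m u x _ hx)) => n.
  by have [[? ?] ?] := hu n.
exists (dof x); split=> // l hl.
case: (Rle_lt_dec m0 (dfun l)) => h; last lra.
by have := hx (dco l); rewrite /superlevel dcoK; apply.
Qed.

Lemma Lstar_bounded : bounded_set (fun y => Lstar (dof y)).
Proof.
have [ls [hD _]] := Lstar_nonempty.
have [B hB] := superlevel_bounded (dfun ls); exists B => y [hy1 hy2].
by apply: hB; split=> //; apply: hy2.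
Qed.

Lemma Lstar_closed : seq_closed (fun y => Lstar (dof y)).
Proof.
move=> u x hu hx.
have hD : inD (dof x).
  apply: (proj1 (@superlevel_closed (dfun (dof (u 0%N))) u x _ hx)) => n.
  have [h1 h2] := hu n; split=> //; apply: h2; exact: (proj1 (hu 0%N)).
split=> // l hl.
apply: (proj2 (@superlevel_closed (dfun l) u x _ hx)) => n.
by have [h1 h2] := hu n; split=> //; apply: h2.
Qed.

Lemma dist2_continuous l : seq_continuous (fun y => dist2 (dof y) l).
Proof.
move=> u x hu; rewrite /dist2 dofK.
apply: (Un_cv_eq (u := fun n => wsq wgt (fun s => u n s - dco l s))).
  by move=> n; rewrite dofK.
exact: wsq_continuous.
Qed.

Lemma Lstar_nonempty_coord : exists y, Lstar (dof y).
Proof. by have [ls h] := Lstar_nonempty; exists (dco ls); rewrite dcoK. Qed.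

Lemma Lstar_nearest l :
  exists ls, Lstar ls /\ forall ls', Lstar ls' -> normW (dsub ls l) <= normW (dsub ls' l).
Proof.
have [x [hx h]] := continuous_min_exists Lstar_nonempty_coord Lstar_bounded Lstar_closed
  (@dist2_continuous l).
exists (dof x); split=> // ls' hls'; apply: normW_dsub_le.
by rewrite -(dcoK ls'); apply: h; rewrite dcoK.
Qed.

Lemma Lstar_farthest l :
  exists ls, Lstar ls /\ forall ls', Lstar ls' -> normW (dsub l ls') <= normW (dsub l ls).
Proof.
have [x [hx h]] := continuous_max_exists Lstar_nonempty_coord Lstar_bounded Lstar_closed
  (@dist2_continuous l).
exists (dof x); split=> // ls' hls'; apply: normW_dsub_le.
by rewrite dist2_sym (dist2_sym l) -(dcoK ls'); apply: h; rewrite dcoK.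
Qed.

(** In the three-point inequality with both points equal to [ls], the left side is nonnegative by
    optimality, so the step has length zero. *)
Lemma DGstep_Lstar_fixed ls s : Lstar ls -> posD (gstep ls) s = dco ls s.
Proof.
move=> [hD hmax]; have := DGstep_progress ls hD.
have := hmax _ (DGstep_inD ls).
have -> : dist2 ls ls = 0 by apply: rsum_eq0 => s'; ring.
move=> h1 h2; have : dist2 ls (DGstep ls) <= 0 by lra.
move/(wsq_eq0 wgt_gt0)/(_ s); rewrite DGstepE dofK; lra.
Qed.

(* A maximizer is a fixed point of the dual gradient step, which is the KKT
   system for its Lagrangian minimizer. *)
Lemma strong_duality ls : Lstar ls -> fstar A C b c f = dfun ls.
Proof.
move=> hls; have hfix := DGstep_Lstar_fixed (ls := ls) _ hls.
set z := zopt ls.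
have feas s : match s with inl _ => res z s = 0 | inr _ => res z s <= 0 end /\
    dco ls s * res z s = 0.
  have hr s' : res z s' = wgt s' * (res z s' / wgt s').
    by field; have := wgt_gt0 s'; lra.
  case: s => t; have hw := wgt_gt0; rewrite hr; lazy beta iota.
    have : dco ls (inl t) + res z (inl t) / wgt (inl t) = dco ls (inl t) := hfix (inl t).
    move: (res z _ / _) => q h; have -> : q = 0 by lra.
    by split; ring.
  have : Rmax 0 (dco ls (inr t) + res z (inr t) / wgt (inr t)) = dco ls (inr t) := hfix (inr t).
  have /inD_coord /(_ t) := proj1 hls; have := hw (inr t).
  (* Complementary slackness: either the clipping is inactive and [q = 0], or the multiplier is 0
     and [q < 0]. *)
  move: (res z _ / _) => q hwt h0; rewrite /Rmax; case: Rle_dec => h1 h2.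
    have -> : q = 0 by lra.
    by split; lra.
  by split; nra.
apply: min_value_eq; split.
  exists z; split.
    split=> j r.
      have [/= h _] := feas (inl (Tagged (fun j => 'I_(pv j)) r)).
      exact: Rminus_diag_uniq h.
    have [/= h _] := feas (inr (Tagged (fun j => 'I_(qv j)) r)).
    exact: Rminus_le h.
  rewrite dfunE Lag_coord -/z rsum_eq0; first ring.
  by move=> s; case: (feas s).
(* Weak duality: at a feasible point the multiplier term is nonpositive. *)
move=> z' [hA hC]; have := dfun_le ls z'; rewrite Lag_coord.
suff : 0 <= \rsum_s (- 1 * (dco ls s * res z' s)) by rewrite rsum_scal; lra.
apply: rsum_ge0 => -[t|t].
  have -> : res z' (inl t) = 0 by exact: Rminus_diag_eq (hA _ (tagged t)).
  lra.
have : res z' (inr t) <= 0 by exact: Rle_minus (hC _ (tagged t)).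
have /inD_coord /(_ t) := proj1 hls.
by move: (dco _ _) (res _ _) => u v; nra.
Qed.

(** * Linear convergence *)

Local Notation Tcal := (Tcal A C b c f sigma E).
Local Notation Rcal := (Rcal A C b c f sigma E).
Local Notation fstar := (fstar A C b c f).

Lemma dfun_le_fstar l : inD l -> dfun l <= fstar.
Proof.
by have [ls hls] := Lstar_nonempty; rewrite (strong_duality hls); case: hls => _; apply.
Qed.

(** A step brings the point no farther from any dual optimum; this is applied to the optimum
    farthest from the new point. *)
Lemma Tcal_DGstep l : Tcal (DGstep l) <= Tcal l.
Proof.
have T l' : exists ls, [/\ Lstar ls, Tcal l' = normW (dsub l' ls) &
    forall ls', Lstar ls' -> normW (dsub l' ls') <= Tcal l'].
  have [ls [h1 h2]] := Lstar_farthest l'; exists ls.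
  have -> : Tcal l' = normW (dsub l' ls); last by split.
  by apply: max_value_eq; split=> //; exists ls.
have [ls [hls -> _]] := T (DGstep l); have [_ [_ _ h]] := T l.
apply: Rle_trans (h _ hls); apply: normW_dsub_le.
rewrite dist2_sym (dist2_sym l).
have := DGstep_progress l (proj1 hls); have := dfun_le_fstar (DGstep_inD l).
rewrite (strong_duality hls); lra.
Qed.

Lemma DGstep_first l : fstar - dfun (DGstep l) <= / 2 * Rcal l ^ 2.
Proof.
have [ls [h1 h2]] := Lstar_nearest l.
have -> : Rcal l = normW (dsub ls l).
  by apply: min_value_eq; split=> //; exists ls.
rewrite -[_ ^ 2]/(_ * (_ * 1)) Rmult_1_r normW_dsub_sqr (strong_duality h1).
by have := DGstep_progress l (proj1 h1); have := dist2_ge0 ls (DGstep l); lra.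
Qed.

Lemma DGstep_contraction kappa l : 0 < kappa -> inD l ->
  normW (dsub l (projW A C sigma E Lstar l)) <= kappa * normW (proxres l) ->
  fstar - dfun (DGstep l) <=
    4 * (1 + kappa) / (1 + 4 * (1 + kappa)) * (fstar - dfun l).
Proof.
move=> hk hl; set ls := projW _ _ _ _ _ _.
have [hls _] : Lstar ls /\ _ := argmin_onP (dual0 pv qv) (Lstar_nearest l).
rewrite proxresE => herr.
have r2 : dist2 ls l <= kappa * kappa * dist2 (DGstep l) l.
  rewrite dist2_sym -!normW_dsub_sqr.
  have n0 : 0 <= normW (dsub l ls) by apply: sqrt_pos.
  have := Rmult_le_compat _ _ _ _ n0 n0 herr herr; lra.
have h1 := DGstep_progress l hl.
have d00 : dist2 l l = 0 by apply: rsum_eq0 => s; ring.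
rewrite d00 in h1.
have h2 := DGstep_progress l (proj1 hls).
set d2 := dist2 (DGstep l) l in r2.
have d0 : 0 <= d2 by apply: dist2_ge0.
rewrite (dist2_sym l) -/d2 in h1.
(* Young's inequality on the cross term of the three-point identity. *)
have young : / 2 * dist2 ls l - / 2 * dist2 ls (DGstep l) + / 2 * d2 <=
    / 2 * (kappa * d2 + / kappa * dist2 ls l).
  rewrite /d2 /dist2 /wsq -!rsum_scal -rsum_sub -!rsum_add -!rsum_scal.
  apply: rsum_le => s; have hw := wgt_gt0 s.
  set x := dco ls s; set y := dco (DGstep l) s; set u := dco l s.
  have : 0 <= / 2 * wgt s * / kappa * ((kappa * (y - u) - (x - u)) * (kappa * (y - u) - (x - u))).
    apply: Rmult_le_pos; last exact: Rle_0_sqr.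
    apply: Rmult_le_pos; first lra.
    exact/Rlt_le/Rinv_0_lt_compat.
  have -> : / 2 * wgt s * / kappa * ((kappa * (y - u) - (x - u)) * (kappa * (y - u) - (x - u)))
    = / 2 * wgt s * (kappa * ((y - u) * (y - u)) - 2 * ((y - u) * (x - u))
       + / kappa * ((x - u) * (x - u))) by field; lra.
  lra.
(* Young's parameter was taken to be [kappa] so that the squared error bound turns its second term
   into [kappa * d2] as well. *)
have hk2 : / kappa * dist2 ls l <= kappa * d2.
  apply: (Rmult_le_reg_l kappa) => //; rewrite -Rmult_assoc Rinv_r; lra.
rewrite (strong_duality hls).
set F := dfun ls - dfun l; set F' := dfun ls - dfun (DGstep l).
have a1 : F' <= kappa * d2 by rewrite /F'; lra.
have a2 : d2 <= 2 * (F - F') by rewrite /F /F'; lra.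
(* The two bounds give [F' <= 2 * kappa * (F - F')] with [F - F' >= 0]; the coefficient is then
   enlarged to [4 * (1 + kappa)]. *)
apply: (Rmult_le_reg_l (1 + 4 * (1 + kappa))); first lra.
have -> : (1 + 4 * (1 + kappa)) * (4 * (1 + kappa) / (1 + 4 * (1 + kappa)) * F) =
  4 * (1 + kappa) * F by field; lra.
nra.
Qed.

Lemma DG_linear_rate kappa (lam : nat -> dvec) : 0 < kappa ->
  inD (lam 0%N) -> (forall k, lam k.+1 = DGstep (lam k)) ->
  (forall l, inD l -> Tcal l <= Tcal (lam 0%N) ->
     normW (dsub l (projW A C sigma E Lstar l)) <= kappa * normW (proxres l)) ->
  forall k, fstar - dfun (lam k.+1) <=
    / 2 * (4 * (1 + kappa) / (1 + 4 * (1 + kappa))) ^ k * Rcal (lam 0%N) ^ 2.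
Proof.
move=> hk H0 Hstep Herr; set rho := _ / _.
have rho0 : 0 < rho by apply: Rdiv_lt_0_compat; lra.
(* This invariant keeps every iterate in the region where the error bound is assumed. *)
have inv k : inD (lam k) /\ Tcal (lam k) <= Tcal (lam 0%N).
  elim: k => [|k [_ IH]]; first by split=> //; lra.
  rewrite Hstep; split; first exact: DGstep_inD.
  exact: Rle_trans (Tcal_DGstep _) IH.
elim=> [|k IH]; first by rewrite Hstep; have := DGstep_first (lam 0%N); simpl; lra.
have [hD hT] := inv k.+1.
rewrite Hstep; apply: Rle_trans (DGstep_contraction hk hD (Herr _ hD hT)) _.
rewrite -/rho -tech_pow_Rmult; have := Rmult_le_compat_l _ _ _ (Rlt_le _ _ rho0) IH; lra.
Qed.

End DualProblem.

(** * The rate with exponent [k - 1] *)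

Unset Implicit Arguments. Set Strict Implicit.

Theorem theorem2
  (M Mb : nat) (nv : 'I_M -> nat) (pv qv : 'I_Mb -> nat)
  (A : forall (j : 'I_Mb) (i : 'I_M), 'I_(pv j) -> 'I_(nv i) -> R)
  (C : forall (j : 'I_Mb) (i : 'I_M), 'I_(qv j) -> 'I_(nv i) -> R)
  (b : forall j : 'I_Mb, vec (pv j)) (c : forall j : 'I_Mb, vec (qv j))
  (f : forall i : 'I_M, vec (nv i) -> R) (sigma : 'I_M -> R)
  (E : 'I_Mb -> 'I_M -> bool)
  (* sparsity pattern *)
  (HE : forall j i, E j i = false ->
          (forall r k, A j i r k = 0) /\ (forall r k, C j i r k = 0))
  (* standing: each f_i convex; W positive definite *)
  (Hconv : forall i, convex (f i))
  (HW : Wposdef A C sigma E)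
  (* Assumption 1(a) *)
  (Hsig : forall i, 0 < sigma i)
  (Hsc : forall i, strongly_convex (sigma i) (f i))
  (Hgrad : forall i, exists (g : vec (nv i) -> vec (nv i)) (L : R),
             is_gradient (f i) g /\ lipschitz_map L g)
  (* Assumption 1(b) *)
  (Hrank : A_full_row_rank A)
  (Hslater : exists zt : primal nv,
     (forall j r, Az A zt j r = b j r) /\ (forall j r, Cz C zt j r < c j r))
  (* Algorithm (DG) *)
  (lam : nat -> dualv pv qv) (z : nat -> primal nv)
  (H0 : inD (lam 0%nat))
  (Hz : forall k (z' : primal nv), Lag A C b c f (z k) (lam k) <= Lag A C b c f z' (lam k))
  (Hstep : forall k, lam (S k) = DGstep A C b c f sigma E (lam k))
  (* error bound *)
  (kappa : R) (Hkappa : 0 < kappa)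
  (Herr : forall l : dualv pv qv, inD l ->
     Tcal A C b c f sigma E l <= Tcal A C b c f sigma E (lam 0%nat) ->
     normW A C sigma E (dsub l (projW A C sigma E (Lstar A C b c f) l))
       <= kappa * normW A C sigma E (proxres A C b c f sigma E l)) :
  let rho := 4 * (1 + kappa) / (1 + 4 * (1 + kappa)) in
  forall k : nat,
    fstar A C b c f - dfun A C b c f (lam (S k))
      <= / 2 * powerRZ rho (Z.of_nat k - 1)%Z * (Rcal A C b c f sigma E (lam 0%nat)) ^ 2.
Proof.
move=> rho k.
have Hcont i : seq_continuous (f i).
  by have [g [L [hg _]]] := Hgrad i; exact: gradient_seq_continuous hg.
have rate : fstar A C b c f - dfun A C b c f (lam k.+1) <=
    / 2 * rho ^ k * Rcal A C b c f sigma E (lam 0%N) ^ 2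
  by exact: (DG_linear_rate HE HW Hsig Hsc Hcont Hrank Hslater Hkappa H0 Hstep Herr).
apply: Rle_trans rate _; apply: Rmult_le_compat_r; first exact: pow2_ge_0.
apply: Rmult_le_compat_l; first lra.
have rho0 : 0 < rho by apply: Rdiv_lt_0_compat; lra.
have rho1 : rho <= 1.
  apply: (Rmult_le_reg_l (1 + 4 * (1 + kappa))); first lra.
  rewrite /rho; field_simplify; lra.
have hpos := powerRZ_lt rho (Z.of_nat k - 1) rho0.
(* The integer power covers [k = 0], where the exponent is -1. Since [0 < rho <= 1], the extra
   factor [rho] only decreases the bound. *)
have -> : rho ^ k = powerRZ rho (Z.of_nat k - 1) * rho.
  rewrite pow_powerRZ -[X in _ * X]powerRZ_1 -powerRZ_add; last lra.
  by congr powerRZ; lia.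
nra.
Qed.
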